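(* Let $A,B\in\mathcal{S}_n$, $X\in\mathcal{M}_n$, $r\ge0$, $\mu\in[0,1]$, $p\in(0,1)$, and let $|||\cdot|||$ be any unitarily invariant norm on $\mathcal{M}_n$. Define $f(t)=|||\,|A^{t}XB^{1-t}|^r\,|||\;|||\,|A^{1-t}XB^{t}|^r\,|||$ for $t\in[0,1]$. Then \begin{align*} |||\,|A^{\mu}XB^{1-\mu}|^r\,|||\;|||\,|A^{1-\mu}XB^{\mu}|^r\,|||-|||\,|A^{1/2}XB^{1/2}|^r\,|||^2 \ge \frac1p\left(f\Big(\frac{1-p}{2}+p\mu\Big)-|||\,|A^{1/2}XB^{1/2}|^r\,|||^2\right)\ge 0. \end{align*}
   Context: $\mathcal{M}_n$ is the algebra of $n\times n$ complex matrices, and $\mathcal{S}_n\subset\mathcal{M}_n$ is the set of positive semidefinite matrices. For $T\in\mathcal{M}_n$, $|T|=(T^*T)^{1/2}$. Nonnegative real powers of positive semidefinite matrices are taken by functional calculus, with the zeroth power equal to the identity matrix. A norm $|||\cdot|||$ on $\mathcal{M}_n$ is unitarily invariant if $|||UTV|||=|||T|||$ for all $T\in\mathcal{M}_n$ and all unitary $U,V\in\mathcal{M}_n$. *)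

(* Defs.v *)
From mathcomp Require Export all_boot all_order all_algebra.
From mathcomp Require Export complex.
From mathcomp Require Export reals exp.

Set Implicit Arguments.
Unset Strict Implicit.
Unset Printing Implicit Defensive.

Import Order.TTheory GRing.Theory Num.Theory.

Local Open Scope ring_scope.
Local Open Scope complex_scope.
Local Open Scope sesquilinear_scope.

(* In [R[i]], [0 <= z] says that [z] is real and nonnegative. *)
Definition psdmx (R : realType) (n : nat) (A : 'M[R[i]]_n) : Prop :=
  A \is hermsymmx /\ forall v : 'cV[R[i]]_n, 0 <= (v^t* *m A *m v) 0 0.

(* Functional calculus for Hermitian matrices (for which the eigenvalues,
   the entries of [spectral_diag A], are real and
   [A = invmx P *m diag_mx (spectral_diag A) *m P] with [P] unitary). *)
Definition mxcalc (R : realType) (n : nat) (f : R -> R) (A : 'M[R[i]]_n) :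
    'M[R[i]]_n :=
  invmx (spectralmx A)
    *m diag_mx (map_mx (fun z : R[i] => (f (complex.Re z))%:C)
                       (spectral_diag A))
    *m spectralmx A.

(* [powR a 0 = 1] for every [a], including [a = 0], so [mxpow A 0 = 1%:M];
   [powR 0 t = 0] for [t != 0]. *)
Definition mxpow (R : realType) (n : nat) (A : 'M[R[i]]_n) (t : R) :
    'M[R[i]]_n :=
  mxcalc (fun a => powR a t) A.

Definition absmx (R : realType) (n : nat) (T : 'M[R[i]]_n) : 'M[R[i]]_n :=
  mxpow (T^t* *m T) (1 / 2).

Record matrix_norm (R : realType) (n : nat) (N : 'M[R[i]]_n -> R) : Prop := {
  matrix_norm_ge0 : forall T, 0 <= N T;
  matrix_norm_eq0 : forall T, N T = 0 -> T = 0;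
  matrix_normZ : forall (c : R[i]) T, N (c *: T) = complex.Re `|c| * N T;
  matrix_normD : forall S T, N (S + T) <= N S + N T
}.

Definition unitarily_invariant_norm (R : realType) (n : nat)
    (N : 'M[R[i]]_n -> R) : Prop :=
  matrix_norm N /\
  forall T U V : 'M[R[i]]_n, U \is unitarymx -> V \is unitarymx ->
    N (U *m T *m V) = N T.

(* Main.v *)
Require Import Defs.
From mathcomp Require Import all_boot all_order all_algebra all_fingroup.
From mathcomp Require Import complex.
From mathcomp Require Import reals exp.
From mathcomp Require Import ring lra.

(** The squared norm of |A^(1/2) X B^(1/2)|^r is f (1/2), so the theorem holds once
    f is known to be convex on [0, 1] and smallest at 1/2.  Both facts follow from one
    inequality.  Write g t for the norm of |A^t X B^(1-t)|^r, so that
    f t = g t * g (1 - t).  Then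
      g t ^ 2 <= g (t + s) * g (t - s)                                    (1)
    whenever 0 <= s <= t and t + s <= 1 ([norm_log_convex]).  Multiplied with
    its mirror image and combined with the arithmetic-geometric mean inequality,
    it makes f midpoint convex; as f (1 - t) = f t, the midpoint of t and 1 - t
    gives f (1/2) <= f t.  Since f is bounded on [0, 1] ([norm_bounded01]),
    midpoint convexity gives convexity ([midpoint_convex_segment]).
    Boundedness takes the place of continuity because A^t may jump at t = 0 when
    A is singular.

    Inequality (1) is the case A^s, A^(t-s) X B^(1-t-s), B^s of
      ||| |AXB|^r |||^2 <= ||| |A^2 X|^r ||| * ||| |X B^2|^r |||
    for Hermitian A, B and arbitrary X ([norm_sandwich]).  If a, b, c are the
    decreasing singular values of AXB, A^2 X and X B^2, the heart of the
    matter is the family of inequalities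
      (a_1 ... a_k)^2 <= (b_1 ... b_k) (c_1 ... c_k)                      (2)
    ([prod_spectral_sandwich], for the squares).  It holds because the nonzero eigenvalues of
    (AXB)^* (AXB) = B X^* A^2 X B are those of (A^2 X)^* (X B^2): on the span
    of k eigenvectors the determinant of that product of two matrices is
    bounded by the Cauchy-Schwarz inequality for Gram determinants, which in
    turn comes from the Cauchy-Binet formula.

    From (2) to norms: a unitarily invariant norm restricted to real diagonal
    matrices is a symmetric gauge function, whose value at the r-th powers of
    the singular values of T is the norm of |T|^r ([symmetric_gauge_norm],
    [singular_values]).  Raising (2) to the power r and replacing the
    geometric mean of b^r and c^r by the larger (t b^r + c^r / t) / 2 turns (2)
    into weak log-majorization, hence weak majorization ([sum_le_of_prod_le]),
    hence an inequality of gauges by Ky Fan dominance ([gauge_dominance]);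
    optimizing over t gives the product on the right ([gauge_log_majorization]). *)

Set Implicit Arguments.
Unset Strict Implicit.
Unset Printing Implicit Defensive.

Import Order.TTheory GRing.Theory Num.Theory.

Local Open Scope ring_scope.
Local Open Scope sesquilinear_scope.

(** * Cauchy-Binet and Gram determinants *)

(** Multilinearity of the determinant in the rows of the product: each row of
    [A *m B] is a combination of rows of [B], and [f] records the choice of one
    summand in each row. *)
Lemma det_mulmx_sum_ffun (K : comPzRingType) k n (A : 'M[K]_(k, n))
    (B : 'M[K]_(n, k)) :
  \det (A *m B)
  = \sum_(f : {ffun 'I_k -> 'I_n}) (\prod_i A i (f i)) * \det (rowsub f B).
Proof.
transitivity (\sum_(s : 'S_k) \sum_(f : {ffun 'I_k -> 'I_n})
    (-1) ^+ s * \prod_i (A i (f i) * B (f i) (s i))).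
  apply: eq_bigr => s _; rewrite -big_distrr /=; congr (_ * _).
  rewrite -(bigA_distr_bigA (fun i j => A i j * B j (s i))) /=.
  by apply: eq_bigr => i _; rewrite mxE.
rewrite exchange_big; apply: eq_bigr => f _ /=.
rewrite big_distrr /=; apply: eq_bigr => s _.
rewrite big_split /= mulrCA; congr (_ * (_ * _)).
by apply: eq_bigr => i _; rewrite mxE.
Qed.

(** The Cauchy-Binet formula, with subsets of size k replaced by all maps from
    ['I_k] to ['I_n]: non-injective maps contribute 0, and each subset is the image of
    k! injective ones.  This form needs no enumeration of subsets; it comes from
    averaging the multilinear expansion over the permutations of the rows. *)
Lemma det_mulmx_fact (K : comPzRingType) k n (A : 'M[K]_(k, n))
    (B : 'M[K]_(n, k)) :
  \det (A *m B) *+ k`!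
  = \sum_(f : {ffun 'I_k -> 'I_n}) \det (colsub f A) * \det (rowsub f B).
Proof.
under eq_bigr => f _ do rewrite [\det (colsub _ _)]/determinant big_distrl /=.
rewrite exchange_big /=.
under eq_bigr => s _.
  (* Permute the choice function so that the factor from [A] loses [s]. *)
  rewrite (reindex_inj (h := fun f : {ffun 'I_k -> 'I_n} =>
            [ffun i => f ((s^-1)%g i)])) /=; last first.
    move=> f g /ffunP fg; apply/ffunP => i.
    by have := fg (s i); rewrite !ffunE permK.
  under eq_bigr => f _.
    have -> : \prod_i (colsub [ffun i0 => f ((s^-1)%g i0)] A) i (s i)
              = \prod_i A i (f i).
      by apply: eq_bigr => i _; rewrite mxE ffunE permK.
    have -> : rowsub [ffun i0 => f ((s^-1)%g i0)] B
              = perm_mx s^-1%g *m rowsub f B.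
      by rewrite -row_permE; apply/matrixP => i j; rewrite !mxE ffunE.
    rewrite det_mulmx det_perm odd_permV.
    rewrite mulrCA !mulrA -expr2 sqrr_sign mul1r.
    over.
  rewrite -det_mulmx_sum_ffun.
  over.
by rewrite sumr_const card_Sn.
Qed.

Section Gram.
Variable C : numClosedFieldType.

Lemma det_adjmx n (M : 'M[C]_n) : \det (M^t*) = (\det M)^*.
Proof. by rewrite det_map_mx det_tr. Qed.

(** Lagrange's identity for the moduli. *)
Lemma sum_CauchySchwarz (I : finType) (x y : I -> C) :
  `|\sum_i (x i)^* * y i| ^+ 2
  <= (\sum_i `|x i| ^+ 2) * (\sum_i `|y i| ^+ 2).
Proof.
pose a i := `|x i|; pose b i := `|y i|.
apply: (@le_trans _ _ ((\sum_i a i * b i) ^+ 2)).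
  rewrite lerXn2r ?nnegrE ?normr_ge0 ?sumr_ge0 // => [i _|].
    by rewrite mulr_ge0 ?normr_ge0.
  apply: le_trans (ler_norm_sum _ _ _) _; apply: ler_sum => i _.
  by rewrite normrM norm_conjC.
have real_ab i j : a i * b j \is Num.real by rewrite ger0_real // mulr_ge0 ?normr_ge0.
have : 0 <= \sum_i \sum_j (a i * b j - a j * b i) ^+ 2.
  apply: sumr_ge0 => i _; apply: sumr_ge0 => j _.
  by rewrite real_exprn_even_ge0 // rpredB.
have -> : \sum_i \sum_j (a i * b j - a j * b i) ^+ 2
    = ((\sum_i a i ^+ 2) * (\sum_i b i ^+ 2) - (\sum_i a i * b i) ^+ 2) *+ 2.
  rewrite mulrnBl mulr2n {2}[_ * \sum_i b i ^+ 2]mulrC expr2.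
  rewrite !big_distrlr /= -mulr_natl mulr_sumr -big_split -sumrB /=.
  apply: eq_bigr => i _; rewrite mulr_sumr -big_split -sumrB /=.
  apply: eq_bigr => j _; ring.
by rewrite pmulrn_lge0 // subr_ge0.
Qed.

Lemma det_gram_fact k n (P S : 'M[C]_(n, k)) :
  \det (P^t* *m S) *+ k`!
  = \sum_(f : {ffun 'I_k -> 'I_n}) (\det (rowsub f P))^* * \det (rowsub f S).
Proof.
rewrite det_mulmx_fact; apply: eq_bigr => f _; congr (_ * _).
by rewrite -det_adjmx; congr (\det _); apply/matrixP => i j; rewrite !mxE.
Qed.

(** All that is used of k! in the Cauchy-Binet formula is that it acts as a
    positive scalar. *)
Lemma mulrn_fact_gt0 k : exists2 c : C, 0 < c & forall x : C, x *+ k`! = x * c.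
Proof.
by exists k`!%:R => [|x]; rewrite ?ltr0n ?fact_gt0 // mulr_natr.
Qed.

(** By Cauchy-Binet, [\det (P^t* *m S)] is an inner product of the vectors of
    maximal minors of [P] and [S]. *)
Lemma det_gram_CauchySchwarz k n (P S : 'M[C]_(n, k)) :
  `|\det (P^t* *m S)| ^+ 2 <= \det (P^t* *m P) * \det (S^t* *m S).
Proof.
have [c c0 cE] := mulrn_fact_gt0 k.
rewrite -(ler_pM2r (exprn_gt0 2 c0)).
have -> : `|\det (P^t* *m S)| ^+ 2 * c ^+ 2 = `|\det (P^t* *m S) * c| ^+ 2.
  by rewrite normrM (ger0_norm (ltW c0)) exprMn.
rewrite [c ^+ 2]expr2 mulrACA -!cE !det_gram_fact.
apply: le_trans (sum_CauchySchwarz _ _) _.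
rewrite le_eqVlt; apply/orP; left; apply/eqP.
by congr (_ * _); apply: eq_bigr => f _; rewrite normCK mulrC.
Qed.

(** The largest of m distinct indices is at least m - 1; remove it and
    recurse. *)
Lemma prod_le_prod_head n (d : 'I_n -> C) (s : seq 'I_n) :
    (forall i, 0 <= d i) -> (forall i j : 'I_n, (i <= j)%N -> d j <= d i) ->
    uniq s ->
  \prod_(i <- s) d i <= \prod_(i < n | (i < size s)%N) d i.
Proof.
move=> d0 dd; have [k] := ubnP (size s); elim: k s => // k IH s sk us.
case: (posnP (size s)) => [/size0nil ->|s0]; first by rewrite big_nil big_pred0.
(* Otherwise [s] would embed in fewer indices than it has entries. *)
have [x xs xge] : exists2 x, x \in s & ((size s).-1 <= x)%N.
  apply/hasP; apply: contraT => /hasPn sP.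
  have : (size s <= (size s).-1)%N.
    rewrite -[X in (_ <= X)%N](size_iota 0) -[X in (X <= _)%N](size_map (@nat_of_ord n)).
    apply: uniq_leq_size; first by rewrite (map_inj_uniq val_inj).
    by move=> _ /mapP[i /sP i_s ->]; rewrite mem_iota add0n /= ltnNge.
  by rewrite -ltnS prednK // ltnn.
have mn : ((size s).-1 < n)%N by apply: leq_ltn_trans xge (ltn_ord x).
rewrite (perm_big _ (perm_to_rem xs)) big_cons.
rewrite (bigD1 (Ordinal mn)) /=; last by rewrite prednK.
have -> : \prod_(i < n | (i < size s)%N && (i != Ordinal mn)) d i
          = \prod_(i < n | (i < size (rem x s))%N) d i.
  apply: eq_bigl => i; rewrite size_rem // -val_eqE /=.
  by rewrite [RHS]ltn_neqAle -[in RHS]ltnS prednK // andbC.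
apply: ler_pM => //; last 2 first.
- exact: dd.
- by apply: IH; rewrite ?rem_uniq // size_rem // prednK.
exact: prodr_ge0.
Qed.

(** Cauchy-Binet writes both sides as sums of squared moduli of minors of [W],
    the left one weighted by products of k entries of [d]; injective choices
    have weight at most the product of the first k entries. *)
Lemma det_gram_diag_le k n (d : 'rV[C]_n) (W : 'M[C]_(n, k)) :
    (forall i, 0 <= d 0 i) -> (forall i j : 'I_n, (i <= j)%N -> d 0 j <= d 0 i) ->
  \det (W^t* *m diag_mx d *m W)
  <= (\prod_(i < n | (i < k)%N) d 0 i) * \det (W^t* *m W).
Proof.
move=> d0 dd.
have [c c0 cE] := mulrn_fact_gt0 k.
rewrite -(ler_pM2r c0) -mulrA -mulmxA -!cE !det_gram_fact.
rewrite mulr_sumr; apply: ler_sum => f _.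
have -> : \det (rowsub f (diag_mx d *m W))
          = (\prod_i d 0 (f i)) * \det (rowsub f W).
  have -> : rowsub f (diag_mx d *m W)
            = diag_mx (\row_i d 0 (f i)) *m rowsub f W.
    by apply/matrixP => i j; rewrite [LHS]mxE !mul_diag_mx !mxE.
  by rewrite det_mulmx det_diag; congr (_ * _); apply: eq_bigr => i _; rewrite mxE.
rewrite mulrCA [_^* * _]mulrC -normCK.
case: (boolP (injectiveb f)) => [/injectiveP f_inj|].
  apply: ler_wpM2r; first exact: exprn_ge0.
  have := @prod_le_prod_head n (d 0) [seq f i | i : 'I_k] d0 dd.
  rewrite size_map -cardE card_ord => H.
  have := H (etrans (map_inj_uniq f_inj _) (enum_uniq _)).
  by rewrite big_map big_enum.
(* A repeated row makes the minor vanish. *)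
case/injectivePn => i1 [i2 Di12 Ef12].
rewrite (determinant_alternate Di12) ?normr0 ?expr0n ?mulr0 // => j.
by rewrite !mxE Ef12.
Qed.

Lemma det_gram_ge0 k n (W : 'M[C]_(n, k)) : 0 <= \det (W^t* *m W).
Proof.
have [c c0 cE] := mulrn_fact_gt0 k.
rewrite -(pmulr_lge0 _ c0) -cE det_gram_fact; apply: sumr_ge0 => f _.
by rewrite mulrC -normCK exprn_ge0.
Qed.

Lemma adjmxM m n p (M : 'M[C]_(m, n)) (K : 'M[C]_(n, p)) :
  (M *m K)^t* = K^t* *m M^t*.
Proof. by rewrite trmx_mul map_mxM. Qed.

(** The product of the k largest eigenvalues of [M^t* *m M] bounds how much [M]
    enlarges a k-dimensional squared volume. *)
Lemma det_gram_spectral_le k n (M P : 'M[C]_n) (d : 'rV[C]_n)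
    (W : 'M[C]_(n, k)) :
    P \is unitarymx -> M^t* *m M = P^t* *m diag_mx d *m P ->
    (forall i, 0 <= d 0 i) -> (forall i j : 'I_n, (i <= j)%N -> d 0 j <= d 0 i) ->
  \det ((M *m W)^t* *m (M *m W))
  <= (\prod_(i < n | (i < k)%N) d 0 i) * \det (W^t* *m W).
Proof.
move=> Pu MP d0 dd.
have P1 : P^t* *m P = 1%:M by apply: mulmx1C; apply/unitarymxP.
have -> : (M *m W)^t* *m (M *m W) = (P *m W)^t* *m diag_mx d *m (P *m W).
  by rewrite !adjmxM -!mulmxA [M^t* *m _]mulmxA MP !mulmxA.
have -> : W^t* *m W = (P *m W)^t* *m (P *m W).
  by rewrite adjmxM -mulmxA [P^t* *m _]mulmxA P1 mul1mx.
exact: det_gram_diag_le.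
Qed.

(** * Products of singular values *)

(** Let [V] consist of the first k eigenvectors of the Gram matrix [B G B] of
    [AXB], where [G = X^t* A A X], with diagonal matrix [L] of eigenvalues, and let
    [W = G B V].  Then [M^t* K W = W L] for [M = A A X] and [K = X B B], so that
    [det L] times the Gram determinant of [W] is the mixed Gram determinant of
    [M W] and [K W].  Cauchy-Schwarz and the two volume bounds conclude, after
    division by the Gram determinant of [W]; this is nonzero when [det L] is,
    because [B W = V L]. *)
Lemma prod_spectral_sandwich k n (A B X P Q S : 'M[C]_n) (a b c : 'rV[C]_n) :
    (k <= n)%N -> A^t* = A -> B^t* = B ->
    P \is unitarymx -> Q \is unitarymx -> S \is unitarymx ->
    (A *m X *m B)^t* *m (A *m X *m B) = P^t* *m diag_mx a *m P ->
    (A *m A *m X)^t* *m (A *m A *m X) = Q^t* *m diag_mx b *m Q ->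
    (X *m (B *m B))^t* *m (X *m (B *m B)) = S^t* *m diag_mx c *m S ->
    (forall i, 0 <= a 0 i) ->
    (forall i, 0 <= b 0 i) -> (forall i j : 'I_n, (i <= j)%N -> b 0 j <= b 0 i) ->
    (forall i, 0 <= c 0 i) -> (forall i j : 'I_n, (i <= j)%N -> c 0 j <= c 0 i) ->
  (\prod_(i < n | (i < k)%N) a 0 i) ^+ 2
  <= (\prod_(i < n | (i < k)%N) b 0 i) * \prod_(i < n | (i < k)%N) c 0 i.
Proof.
move=> kn hA hB Pu Qu Su Pa Qb Sc a0 b0 bd c0 cd.
pose J : 'M[C]_(k, n) := rowsub (widen_ord kn) 1%:M.
pose L := diag_mx (\row_(i < k) a 0 (widen_ord kn i)).
pose V := P^t* *m J^t*.
pose G := X^t* *m A *m A *m X.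
pose W := G *m B *m V.
have PP : P *m P^t* = 1%:M by apply/unitarymxP.
have JJ : J *m J^t* = 1%:M.
  apply/matrixP => i j; rewrite mxE (bigD1 (widen_ord kn i)) //= big1 ?addr0.
    rewrite !mxE eqxx mul1r -(inj_eq val_inj) /= eq_sym.
    by rewrite -(inj_eq val_inj) /=; case: (_ == _); rewrite ?rmorph1 ?rmorph0.
  by move=> l lP; rewrite !mxE eq_sym (negPf lP) mul0r.
have VV : V^t* *m V = 1%:M.
  by rewrite /V adjmxM !trmxCK mulmxA -[J *m P *m _]mulmxA PP mulmx1.
have aJ : diag_mx a *m J^t* = J^t* *m L.
  apply/matrixP => i j; rewrite mul_diag_mx mul_mx_diag !mxE.
  by case: eqP => [->|_]; rewrite ?rmorph1 ?rmorph0 ?mulr0 ?mul0r // mulrC.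
have BW : B *m W = V *m L.
  have -> : B *m W = (A *m X *m B)^t* *m (A *m X *m B) *m V.
    by rewrite !adjmxM hA hB /W /G !mulmxA.
  by rewrite Pa /V !mulmxA -[_ *m P *m _]mulmxA PP mulmx1 -mulmxA aJ mulmxA.
pose M := A *m A *m X; pose K := X *m (B *m B).
have MKW : (M *m W)^t* *m (K *m W) = W^t* *m W *m L.
  have -> : K *m W = X *m B *m (V *m L) by rewrite -BW /K !mulmxA.
  by rewrite adjmxM /M !adjmxM hA /W /G !mulmxA.
have detL : \det L = \prod_(i < n | (i < k)%N) a 0 i.
  by rewrite det_diag big_ord_narrow; apply: eq_bigr => i _; rewrite mxE.
rewrite -detL; have [->|L0] := eqVneq (\det L) 0.
  by rewrite expr0n /= mulr_ge0 // prodr_ge0.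
have W_gt0 : 0 < \det (W^t* *m W).
  rewrite lt_def det_gram_ge0 andbT; apply: contra L0 => /eqP W0.
  (* [V^t* B W = V^t* V L = L], and Cauchy-Schwarz bounds [det L]. *)
  have := det_gram_CauchySchwarz (B *m V) W.
  rewrite W0 mulr0 adjmxM hB -mulmxA BW mulmxA VV mul1mx.
  by move=> L2; rewrite -normr_eq0 -sqrf_eq0 eq_le L2 exprn_ge0.
have L_ge0 : 0 <= \det L by rewrite detL prodr_ge0.
rewrite -(ler_pM2l (exprn_gt0 2 W_gt0)) -exprMn -det_mulmx -MKW.
rewrite -[\det _]ger0_norm; last first.
  by rewrite MKW det_mulmx mulr_ge0 // ltW.
apply: le_trans (det_gram_CauchySchwarz _ _) _.
rewrite expr2 mulrACA ![\det (W^t* *m W) * _]mulrC.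
by apply: ler_pM; rewrite ?det_gram_ge0 //;
   [apply: det_gram_spectral_le Qu Qb _ _ | apply: det_gram_spectral_le Su Sc _ _].
Qed.
End Gram.

(** * Majorization and symmetric gauge functions *)

Lemma big_ord_ltnS (T : Type) (idx : T) (op : Monoid.com_law idx) n k
    (kn : (k < n)%N) (F : 'I_n -> T) :
  \big[op/idx]_(i < n | (i < k.+1)%N) F i
  = op (F (Ordinal kn)) (\big[op/idx]_(i < n | (i < k)%N) F i).
Proof.
rewrite (bigD1 (Ordinal kn)) /=; last exact: ltnSn.
congr (op _ _); apply: eq_bigl => i.
by rewrite -val_eqE /= ltnS andbC -ltn_neqAle.
Qed.

Section Majorization.
Variables (R : realType) (n : nat).
Implicit Types x y z : 'rV[R]_n.

Definition decreasing_row x := forall i j : 'I_n, (i <= j)%N -> x 0 j <= x 0 i.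
Definition nonneg_row x := forall i, 0 <= x 0 i.

(** Summation by parts, arranged as an induction that carries the current
    (smallest) weight along. *)
Lemma Abel_sum_ge (x u : 'rV[R]_n) (m : nat) (mn : (m < n)%N) :
    decreasing_row x ->
    (forall k, (k <= m.+1)%N -> 0 <= \sum_(i < n | (i < k)%N) u 0 i) ->
  x 0 (Ordinal mn) * (\sum_(i < n | (i < m.+1)%N) u 0 i)
  <= \sum_(i < n | (i < m.+1)%N) x 0 i * u 0 i.
Proof.
move=> xd; elim: m mn => [|m IH] mn u0.
  by rewrite !(big_ord_ltnS _ mn) !big_pred0 //= !addr0.
rewrite ![\sum_(i < n | (i < m.+2)%N) _](big_ord_ltnS _ mn) /= mulrDr lerD2l.
have mn' := ltnW mn; apply: le_trans (IH mn' _); last first.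
  by move=> k km; apply: u0; apply: leqW.
by apply: ler_wpM2r; [exact: u0 | exact: xd].
Qed.

(** Weak log-majorization implies weak majorization.  Where [x] is positive,
    the ratios [y / x] have partial products at least 1, hence, by
    [1 + u <= exp u], the numbers [u = y / x - 1] have nonnegative partial sums;
    weighting them by the decreasing [x] keeps the sum nonnegative.  Once [x]
    vanishes, further terms can only help the right-hand side. *)
Lemma sum_le_of_prod_le x y :
    decreasing_row x -> nonneg_row x -> nonneg_row y ->
    (forall k, (k <= n)%N ->
       \prod_(i < n | (i < k)%N) x 0 i <= \prod_(i < n | (i < k)%N) y 0 i) ->
  forall k, (k <= n)%N ->
    \sum_(i < n | (i < k)%N) x 0 i <= \sum_(i < n | (i < k)%N) y 0 i.
Proof.
move=> xd x0 y0 xy; elim=> [|m IH] mn; first by rewrite !big_pred0.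
have [xm0|xm_gt0] := leP (x 0 (Ordinal mn)) 0.
  rewrite !(big_ord_ltnS _ mn) /= lerD ?IH 1?ltnW //.
  exact: le_trans xm0 (y0 _).
have x_gt0 (i : 'I_n) : (i < m.+1)%N -> 0 < x 0 i.
  by rewrite ltnS => im; apply: lt_le_trans xm_gt0 (xd i (Ordinal mn) im).
pose u : 'rV[R]_n := \row_i (y 0 i / x 0 i - 1).
have u_ge0 k : (k <= m.+1)%N -> 0 <= \sum_(i < n | (i < k)%N) u 0 i.
  move=> km; rewrite -ler_expR expR0 expR_sum.
  have x_gt0k (i : 'I_n) : (i < k)%N -> 0 < x 0 i.
    by move=> ik; apply: x_gt0; apply: leq_trans km.
  apply: (@le_trans _ _ (\prod_(i < n | (i < k)%N) (y 0 i / x 0 i))).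
    rewrite prodf_div ler_pdivlMr ?prodr_gt0 // mul1r.
    exact: xy (leq_trans km mn).
  apply: ler_prod => i ik; rewrite divr_ge0 //=.
  by apply: le_trans (expR_ge1Dx _); rewrite mxE addrC subrK.
have := Abel_sum_ge mn xd u_ge0; have := u_ge0 _ (leqnn _).
move=> /(mulr_ge0 (x0 (Ordinal mn))) /le_trans H /H {H}.
move=> H; rewrite -subr_ge0 -sumrB; apply: le_trans H _.
rewrite le_eqVlt; apply/orP; left; apply/eqP; apply: eq_bigr => i /x_gt0 xi0.
by rewrite mxE mulrBr mulr1 mulrC divfK // gt_eqF.
Qed.

Record symmetric_gauge (Phi : 'rV[R]_n -> R) : Prop := {
  gauge_ge0 : forall x, 0 <= Phi x;
  gaugeD : forall x y, Phi (x + y) <= Phi x + Phi y;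
  gaugeZ : forall (t : R) x, 0 <= t -> Phi (t *: x) = t * Phi x;
  gauge_perm : forall (s : 'S_n) x, Phi (col_perm s x) = Phi x;
  gauge_flip : forall (j : 'I_n) x,
    Phi (\row_i (if i == j then - x 0 i else x 0 i)) = Phi x
}.

Variable Phi : 'rV[R]_n -> R.
Hypothesis hPhi : symmetric_gauge Phi.

Lemma gauge_convex (t : R) x y :
  0 <= t <= 1 -> Phi x <= Phi y -> Phi ((1 - t) *: y + t *: x) <= Phi y.
Proof.
move=> /andP[t0 t1] xy; apply: le_trans (gaugeD hPhi _ _) _.
rewrite !(gaugeZ hPhi) ?subr_ge0 //.
by have := ler_wpM2l t0 xy; lra.
Qed.

(** Moving mass from a larger entry to a smaller one, by at most their
    difference, is averaging [x] with a transposition of [x]. *)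
Lemma gauge_transfer x (j l : 'I_n) (e : R) :
    x 0 l < x 0 j -> 0 <= e <= x 0 j - x 0 l ->
  Phi (x + e *: (delta_mx 0 l - delta_mx 0 j)) <= Phi x.
Proof.
move=> xlj /andP[e0 e1]; have d0 : 0 < x 0 j - x 0 l by rewrite subr_gt0.
have -> : x + e *: (delta_mx 0 l - delta_mx 0 j)
    = (1 - e / (x 0 j - x 0 l)) *: x
      + (e / (x 0 j - x 0 l)) *: col_perm (tperm j l) x.
  have jl : j != l by apply: contraTneq xlj => ->; rewrite ltxx.
  apply/rowP => i; rewrite !mxE /=; case: tpermP => [->|->|/eqP ij /eqP il].
  - by rewrite eqxx (negPf jl) /=; field; rewrite gt_eqF.
  - by rewrite eqxx eq_sym (negPf jl) /=; field; rewrite gt_eqF.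
  - by rewrite (negPf ij) (negPf il) /=; ring.
apply: gauge_convex; last by rewrite (gauge_perm hPhi).
by rewrite divr_ge0 ?ler_pdivrMr ?mul1r // ltW.
Qed.

(** Lowering an entry to a smaller nonnegative value is averaging [x] with the
    vector in which the sign of that entry is flipped. *)
Lemma gauge_shrink x (j : 'I_n) (v : R) :
    0 <= v <= x 0 j ->
  Phi (x + (v - x 0 j) *: delta_mx 0 j) <= Phi x.
Proof.
move=> /andP[v0 vx]; have [xj0|xj_le0] := ltP 0 (x 0 j); last first.
  have -> : v - x 0 j = 0 by lra.
  by rewrite scale0r addr0.
have -> : x + (v - x 0 j) *: delta_mx 0 j
    = (1 - (1 - v / x 0 j) / 2) *: x
      + ((1 - v / x 0 j) / 2) *: \row_i (if i == j then - x 0 i else x 0 i).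
  apply/rowP => i; rewrite !mxE /=; case: eqP => [->|_] /=.
    by field; rewrite gt_eqF.
  by ring.
apply: gauge_convex; last by rewrite (gauge_flip hPhi).
have : 0 <= v / x 0 j <= 1 by rewrite divr_ge0 ?ler_pdivrMr ?mul1r // ltW.
lra.
Qed.

Lemma sum_delta_lt k (l : 'I_n) :
  \sum_(i < n | (i < k)%N) (i == l)%:R = (l < k)%N%:R :> R.
Proof.
case: (boolP (l < k)%N) => lk.
  by rewrite (bigD1 l) //= eqxx big1 ?addr0 // => i /andP[_ /negPf ->].
by apply: big1 => i ik; case: eqP lk => // <-; rewrite ik.
Qed.

(** Ky Fan dominance, by induction on the number of indices where [x] and [y]
    differ.  If [x <= y] everywhere, shrink one entry of [y].  Otherwise take the
    first [l] with [y l < x l]; the partial sums force some [j < l] with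
    [x j < y j], and transferring the right amount from [j] to [l] in [y] makes
    one of the two entries agree with [x] without breaking the partial sum
    inequalities.  The argument never orders [y], so it can be repeated after a
    transfer. *)
Lemma gauge_dominance x y :
    decreasing_row x -> nonneg_row x ->
    (forall k, (k <= n)%N ->
       \sum_(i < n | (i < k)%N) x 0 i <= \sum_(i < n | (i < k)%N) y 0 i) ->
  Phi x <= Phi y.
Proof.
move=> xd x0; have [m] := ubnP #|[set i | x 0 i != y 0 i]|.
elim: m y => // m IH y ym xy.
have step z : Phi z <= Phi y ->
    [set i | x 0 i != z 0 i] \proper [set i | x 0 i != y 0 i] ->
    (forall k, (k <= n)%N ->
       \sum_(i < n | (i < k)%N) x 0 i <= \sum_(i < n | (i < k)%N) z 0 i) ->
    Phi x <= Phi y.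
  move=> zy zP xz; apply: le_trans zy; apply: IH xz.
  exact: leq_trans (proper_card zP) ym.
case: (pickP (fun l => y 0 l < x 0 l)) => [l0 l0P|no_lt]; last first.
  case: (pickP (fun l => x 0 l != y 0 l)) => [j jP|all_eq]; last first.
    suff -> : x = y by [].
    by apply/rowP => i; apply/eqP; rewrite -[_ == _]negbK all_eq.
  have le_xy i : x 0 i <= y 0 i by rewrite leNgt no_lt.
  have zE i : (y + (x 0 j - y 0 j) *: delta_mx 0 j) 0 i
              = if i == j then x 0 i else y 0 i.
    by rewrite !mxE /=; case: eqP => [->|_] /=; ring.
  apply: (step (y + (x 0 j - y 0 j) *: delta_mx 0 j)).
  - by apply: gauge_shrink; rewrite x0 le_xy.
  - apply/properP; split; last first.
      by exists j; rewrite !inE ?jP // zE !eqxx.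
    by apply/subsetP => i; rewrite !inE zE; case: (i == j) => //; rewrite eqxx.
  - move=> k kn; apply: ler_sum => i _; rewrite zE; case: (i == j) => //.
have [l lP l_min] :=
  @arg_minnP _ l0 (fun l => y 0 l < x 0 l) (fun i : 'I_n => i : nat) l0P.
have le_xy (i : 'I_n) : (i < l)%N -> x 0 i <= y 0 i.
  by move=> il; rewrite leNgt; apply: contraTN il => /l_min; rewrite -leqNgt.
have [j jl jP] : exists2 j : 'I_n, (j < l)%N & x 0 j < y 0 j.
  case: (pickP (fun j : 'I_n => (j < l)%N && (x 0 j < y 0 j))) => [j|no_j].
    by case/andP => jl jP; exists j.
  have := xy l.+1 (ltn_ord l); rewrite !(big_ord_ltnS _ (ltn_ord l)) /=.
  have -> : Ordinal (ltn_ord l) = l by apply: val_inj.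
  have -> : \sum_(i < n | (i < l)%N) y 0 i = \sum_(i < n | (i < l)%N) x 0 i.
    apply: eq_bigr => i il; apply/eqP; rewrite eq_le (le_xy i il) andbT.
    by have := no_j i; rewrite il /= ltNge => /negbFE.
  by rewrite lerD2r leNgt lP.
have xlj := xd _ _ (ltnW jl).
(* The largest transfer that overshoots neither entry. *)
pose e := Num.min (y 0 j - x 0 j) (x 0 l - y 0 l).
have e_gt0 : 0 < e by rewrite lt_min !subr_gt0 jP.
have ej : e <= y 0 j - x 0 j by rewrite ge_min lexx.
have el : e <= x 0 l - y 0 l by rewrite ge_min lexx orbT.
pose z := y + e *: (delta_mx 0 l - delta_mx 0 j).
have neq_jl : (j == l) = false by apply: contraTF jl => /eqP ->; rewrite ltnn.
have zj : z 0 j = y 0 j - e by rewrite !mxE !eqxx neq_jl /=; ring.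
have zl : z 0 l = y 0 l + e by rewrite !mxE !eqxx [l == j]eq_sym neq_jl /=; ring.
apply: (step z).
- apply: gauge_transfer; first by lra.
  by apply/andP; split; lra.
- apply/properP; split.
    apply/subsetP => i; rewrite !inE.
    have [->|ij] := eqVneq i j; first by rewrite (lt_eqF jP).
    have [->|il] := eqVneq i l; first by rewrite (gt_eqF lP).
    by rewrite !mxE (negPf ij) (negPf il) /= subrr mulr0 addr0.
  case: (leP (y 0 j - x 0 j) (x 0 l - y 0 l)) => h.
    exists j; rewrite !inE ?(lt_eqF jP) // zj /e min_l // negbK; apply/eqP; ring.
  exists l; rewrite !inE ?(gt_eqF lP) // zl /e min_r ?ltW // negbK; apply/eqP; ring.
move=> k kn.
have -> : \sum_(i < n | (i < k)%N) z 0 i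
    = \sum_(i < n | (i < k)%N) y 0 i + e * ((l < k)%N%:R - (j < k)%N%:R).
  rewrite -!sum_delta_lt -sumrB mulr_sumr -big_split /=.
  by apply: eq_bigr => i _; rewrite !mxE.
(* The transfer changes partial sums only for [j < k <= l]; there [x <= y] on
   all indices below [k], and the gap at [j] alone absorbs [e]. *)
case: (boolP (j < k)%N) => jk; last first.
  have /negPf -> : ~~ (l < k)%N.
    by apply: contra jk => lk; apply: ltn_trans jl lk.
  by rewrite subrr mulr0 addr0 xy.
case: (boolP (l < k)%N) => lk; first by rewrite subrr mulr0 addr0 xy.
rewrite (bigD1 j) // (bigD1 j jk) /=.
have : \sum_(i < n | (i < k)%N && (i != j)) x 0 i
       <= \sum_(i < n | (i < k)%N && (i != j)) y 0 i.
  apply: ler_sum => i /andP[ik _]; apply: le_xy.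
  by apply: leq_trans ik _; rewrite leqNgt.
rewrite sub0r mulrN1; lra.
Qed.

(** Take t = w / u; if u = 0, a large t gives a contradiction. *)
Lemma sqr_le_of_scaled_mean (w u v : R) :
    0 <= w -> 0 <= u -> 0 <= v ->
    (forall t, 0 < t -> w <= (t * u + t^-1 * v) / 2) -> w ^+ 2 <= u * v.
Proof.
move=> w0 u0 v0 H; have [w_gt0|w_le0] := ltP 0 w; last first.
  have -> : w = 0 by lra.
  by rewrite expr0n /= mulr_ge0.
have [u_gt0|u_le0] := ltP 0 u.
  have := H _ (divr_gt0 w_gt0 u_gt0); rewrite divfK ?gt_eqF // invf_div => H1.
  have : w <= u / w * v by lra.
  by rewrite mulrAC ler_pdivlMr.
have u_eq0 : u = 0 by lra.
have v1 : 0 < v + 1 by lra.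
(* With t = (v + 1) / w the bound reads w <= w v / (2 (v + 1)). *)
have := H _ (divr_gt0 v1 w_gt0); rewrite u_eq0 mulr0 add0r invf_div.
rewrite ler_pdivlMr // [w / _ * v]mulrAC ler_pdivlMr // => H1.
by have := mulr_ge0 w0 v0; nra.
Qed.

(** For every [t], [x] is weakly log-majorized by the mean of [t y] and
    [z / t], because that mean dominates the geometric mean of [y] and [z]. *)
Lemma gauge_log_majorization x y z :
    decreasing_row x -> nonneg_row x -> nonneg_row y -> nonneg_row z ->
    (forall k, (k <= n)%N ->
       (\prod_(i < n | (i < k)%N) x 0 i) ^+ 2
       <= (\prod_(i < n | (i < k)%N) y 0 i) * \prod_(i < n | (i < k)%N) z 0 i) ->
  Phi x ^+ 2 <= Phi y * Phi z.
Proof.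
move=> xd x0 y0 z0 xyz.
apply: sqr_le_of_scaled_mean; rewrite ?(gauge_ge0 hPhi) // => t t0.
pose w := (t / 2) *: y + (t^-1 / 2) *: z.
have wE i : w 0 i = (t * y 0 i + t^-1 * z 0 i) / 2 by rewrite !mxE; ring.
have w_ge0 : nonneg_row w.
  by move=> i; rewrite wE divr_ge0 // addr_ge0 // mulr_ge0 // ?invr_ge0 ltW.
apply: (@le_trans _ _ (Phi w)); last first.
  apply: le_trans (gaugeD hPhi _ _) _.
  have t_ge0 := ltW t0; rewrite !(gaugeZ hPhi) ?divr_ge0 ?invr_ge0 //.
  rewrite le_eqVlt; apply/orP; left; apply/eqP; ring.
apply: gauge_dominance => //; apply: sum_le_of_prod_le => // k kn.
rewrite -(@ler_pXn2r _ 2) ?nnegrE ?prodr_ge0 //.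
apply: le_trans (xyz k kn) _; rewrite -big_split -prodrXl /=.
apply: ler_prod => i _; rewrite mulr_ge0 //= wE.
have := (leif_AGM2 (t * y 0 i) (t^-1 * z 0 i)).1.
by rewrite mulrACA divff ?mul1r // gt_eqF.
Qed.
End Majorization.

(** * Real powers of matrices and singular values *)

Section MatrixPowers.
Variables (R : realType) (n : nat).
Local Notation C := (R[i]).
Local Notation "x %:C" := (real_complex R x).
Implicit Types (T A B X : 'M[C]_n).

Definition real_diag (x : 'rV[R]_n) : 'M[C]_n := diag_mx (map_mx (real_complex R) x).

Lemma conj_real_complex (x : R) : (x%:C)^* = x%:C.
Proof. by rewrite conj_Creal //; apply/complex_realP; exists x. Qed.

Lemma real_diag_adj x : (real_diag x)^t* = real_diag x.
Proof.
apply/matrixP => i j; rewrite !mxE eq_sym.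
by case: eqP => [->|_]; rewrite ?mulr1n ?mulr0n ?rmorph0 // conj_real_complex.
Qed.

Lemma real_diagM x y : real_diag x *m real_diag y = real_diag (\row_i (x 0 i * y 0 i)).
Proof.
rewrite mulmx_diag; congr diag_mx; apply/rowP => i.
by rewrite !mxE rmorphM.
Qed.

Lemma adj_unitaryK m (P : 'M[C]_m) : P \is unitarymx -> P^t* *m P = 1%:M.
Proof. by move/unitarymxP/mulmx1C. Qed.

Lemma mxcalcE (f : R -> R) A : mxcalc f A
  = (spectralmx A)^t* *m real_diag (\row_i f (complex.Re (spectral_diag A 0 i)))
      *m spectralmx A.
Proof.
rewrite /mxcalc (invmx_unitary (spectral_unitarymx A)).
suff -> : map_mx (fun z : C => (f (complex.Re z))%:C) (spectral_diag A)
    = map_mx (real_complex R) (\row_i f (complex.Re (spectral_diag A 0 i))) by [].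
by apply/rowP => i; rewrite !mxE.
Qed.

Lemma mxpow_adj A t : (mxpow A t)^t* = mxpow A t.
Proof. by rewrite /mxpow mxcalcE !adjmxM trmxCK real_diag_adj mulmxA. Qed.

Lemma unitary_conj_mul (P D E : 'M[C]_n) : P \is unitarymx ->
  (P^t* *m D *m P) *m (P^t* *m E *m P) = P^t* *m (D *m E) *m P.
Proof.
move=> /unitarymxP Pu.
by rewrite !mulmxA -[_ *m P *m _]mulmxA Pu mulmx1.
Qed.

(** For nonnegative exponents the law also holds at [a = 0], where [powR 0 0 = 1]. *)
Lemma powR_add_ge0 (a s t : R) : 0 <= s -> 0 <= t ->
  powR a (s + t) = powR a s * powR a t.
Proof.
move=> s0 t0; have [st0|st0] := eqVneq (s + t) 0; last first.
  by rewrite powRD // (negPf st0).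
have -> : s = 0 by lra.
have -> : t = 0 by lra.
by rewrite addr0 powRr0 mulr1.
Qed.

Lemma mxpowD A s t : 0 <= s -> 0 <= t -> mxpow A s *m mxpow A t = mxpow A (s + t).
Proof.
move=> s0 t0; rewrite /mxpow !mxcalcE.
rewrite (unitary_conj_mul _ _ (spectral_unitarymx A)) real_diagM.
set x := \row_i (_ * _); set y := \row_i _.
suff -> : x = y by [].
by apply/rowP => i; rewrite !mxE powR_add_ge0.
Qed.

Lemma spectral_form (H : 'M[C]_n) : H \is normalmx ->
  H = (spectralmx H)^t* *m diag_mx (spectral_diag H) *m spectralmx H.
Proof.
by move=> /orthomx_spectralP; rewrite (invmx_unitary (spectral_unitarymx H)).
Qed.

Lemma adj_fixed_normalmx (H : 'M[C]_n) : H^t* = H -> H \is normalmx.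
Proof. by move=> hH; apply/normalmxP; rewrite hH. Qed.

Lemma gram_diag_ge0 m (K : 'M[C]_(m, n)) i : 0 <= (K^t* *m K) i i.
Proof.
rewrite mxE sumr_ge0 // => j _.
by rewrite !mxE mulrC -normCK exprn_ge0.
Qed.

Lemma spectral_diag_gram_ge0 (T : 'M[C]_n) i :
  0 <= spectral_diag (T^t* *m T) 0 i.
Proof.
set H := T^t* *m T; pose P := spectralmx H.
have Pu : P \is unitarymx := spectral_unitarymx H.
have H_adj : H^t* = H by rewrite /H adjmxM trmxCK.
have -> : spectral_diag H 0 i = ((T *m P^t*)^t* *m (T *m P^t*)) i i.
  rewrite adjmxM trmxCK -mulmxA [T^t* *m _]mulmxA -/H.
  rewrite {2}(spectral_form (adj_fixed_normalmx H_adj)) -/P.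
  rewrite -!mulmxA (unitarymxP Pu) mulmx1 mulmxA (unitarymxP Pu) mul1mx.
  by rewrite mxE eqxx.
exact: gram_diag_ge0.
Qed.

Lemma row_RRe (x : 'rV[C]_n) : (forall i, 0 <= x 0 i) ->
  map_mx (real_complex R) (\row_i complex.Re (x 0 i)) = x.
Proof.
by move=> x0; apply/rowP => i; rewrite !mxE RRe_real // ger0_real.
Qed.

Lemma Re_ge0 (z : C) : 0 <= z -> 0 <= complex.Re z.
Proof. by rewrite lecE /= => /andP[]. Qed.

Lemma absmx_sqr T : absmx T *m absmx T = T^t* *m T.
Proof.
have h0 : 0 <= 1 / 2 :> R by lra.
rewrite /absmx (mxpowD _ h0 h0); have -> : 1 / 2 + 1 / 2 = 1 :> R by field.
set H := T^t* *m T.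
have H_adj : H^t* = H by rewrite /H adjmxM trmxCK.
rewrite [RHS](spectral_form (adj_fixed_normalmx H_adj)) /mxpow mxcalcE.
rewrite -[in RHS](row_RRe (spectral_diag_gram_ge0 T)).
set x := \row_i powR _ _; set y := \row_i _; suff -> : x = y by [].
apply/rowP => i; rewrite !mxE powRr1 //.
exact: Re_ge0 (spectral_diag_gram_ge0 T i).
Qed.

(** A square root of [|T|], which shows that [|T|] is positive semidefinite. *)
Lemma absmx_gram T : exists K : 'M[C]_n, absmx T = K^t* *m K.
Proof.
have q0 : 0 <= 1 / 4 :> R by lra.
exists (mxpow (T^t* *m T) (1 / 4)).
rewrite mxpow_adj (mxpowD _ q0 q0) /absmx.
suff -> : 1 / 4 + 1 / 4 = 1 / 2 :> R by [].
by field.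
Qed.

Lemma exists_sorting_perm (x : 'rV[R]_n) :
  exists s : 'S_n, decreasing_row (col_perm s x).
Proof.
pose t := [tuple x 0 i | i < n].
pose u := sort_tuple (fun a b : R => b <= a) t.
have /tuple_permP[s us] : perm_eq u t by rewrite /u /= perm_sort.
exists s => i j ij.
have uE (k : 'I_n) : col_perm s x 0 k = nth 0 u k.
  by rewrite us mxE -tnth_nth !tnth_mktuple.
rewrite !uE.
have ge_trans : transitive (fun a b : R => b <= a).
  by move=> a b c ab cb; apply: le_trans ab.
have ge_refl : reflexive (fun a b : R => b <= a) by move=> a; apply: lexx.
have := sorted_leq_nth ge_trans ge_refl 0 (sort_sorted (fun a b => le_total b a) t).
move=> /(_ i j); rewrite !inE !size_sort size_tuple !ltn_ord.
exact.
Qed.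

Lemma perm_mx_unitary (s : 'S_n) : (perm_mx s : 'M[C]_n) \is unitarymx.
Proof.
apply/unitarymxP; rewrite tr_perm_mx map_perm_mx -perm_mxM mulgV.
exact: perm_mx1.
Qed.

Lemma real_diag_perm (s : 'S_n) x :
  real_diag (col_perm s x) = perm_mx s *m real_diag x *m (perm_mx s)^t*.
Proof.
rewrite tr_perm_mx map_perm_mx -row_permE -col_permE.
by apply/matrixP => i j; rewrite !mxE (inj_eq perm_inj).
Qed.

Variable N : 'M[C]_n -> R.
Hypothesis hN : unitarily_invariant_norm N.

Lemma norm_unitary_conj (P D : 'M[C]_n) : P \is unitarymx ->
  N (P^t* *m D *m P) = N D.
Proof.
move=> Pu; have Pa : P^t* \is unitarymx by rewrite trmxC_unitary.
exact: (hN.2 D _ _ Pa Pu).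
Qed.

(** Permutations and sign changes of a diagonal are multiplications by unitary
    matrices. *)
Lemma symmetric_gauge_norm : symmetric_gauge (fun x => N (real_diag x)).
Proof.
have [[N_ge0 N_eq0 NZ ND] Nu] := hN; split => [x|x y|t x t0|s x|j x].
- exact: N_ge0.
- have -> : real_diag (x + y) = real_diag x + real_diag y; last exact: ND.
  by apply/matrixP => i j; rewrite !mxE rmorphD mulrnDl.
- have -> : real_diag (t *: x) = t%:C *: real_diag x.
    by apply/matrixP => i j; rewrite !mxE rmorphM mulrnAr.
  by rewrite NZ ger0_norm // ler0c.
- rewrite real_diag_perm; apply: Nu; rewrite ?trmxC_unitary; exact: perm_mx_unitary.
- pose e : 'rV[R]_n := \row_i (if i == j then -1 else 1).
  have -> : real_diag (\row_i (if i == j then - x 0 i else x 0 i))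
      = real_diag e *m real_diag x *m 1%:M.
    rewrite mulmx1 real_diagM; congr real_diag; apply/rowP => i; rewrite !mxE.
    by case: eqP; rewrite ?mulN1r ?mul1r.
  apply: Nu.
    apply/unitarymxP; rewrite real_diag_adj real_diagM.
    apply/matrixP => i k; rewrite !mxE.
    case: (i =P k) => [->|_]; last by rewrite !mulr0n.
    by case: (k == j); rewrite ?mulN1r ?opprK ?mulr1 rmorph1.
  by apply/unitarymxP; rewrite trmx1 map_mx1 mulmx1.
Qed.

(** The singular values come from the spectral decomposition of [absmx T], which
    is the one that [mxpow (absmx T) r] is built on, so its norm is read off
    directly; the Gram matrix of [T] is the square of [absmx T].  The eigenvalues
    are sorted by a permutation matrix. *)
Lemma singular_values T : exists s : 'rV[R]_n, exists P : 'M[C]_n,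
  [/\ nonneg_row s, decreasing_row s, P \is unitarymx,
      T^t* *m T = P^t* *m real_diag (\row_i s 0 i ^+ 2) *m P
    & forall r, N (mxpow (absmx T) r) = N (real_diag (\row_i powR (s 0 i) r))].
Proof.
set M := absmx T; pose Q := spectralmx M.
have Qu : Q \is unitarymx := spectral_unitarymx M.
pose d : 'rV[R]_n := \row_i complex.Re (spectral_diag M 0 i).
have M_diag_ge0 i : 0 <= spectral_diag M 0 i.
  by rewrite /M; have [K ->] := absmx_gram T; apply: spectral_diag_gram_ge0.
have M_adj : M^t* = M by rewrite /M /absmx mxpow_adj.
have ME : M = Q^t* *m real_diag d *m Q.
  rewrite [LHS](spectral_form (adj_fixed_normalmx M_adj)) -/Q.
  by rewrite -[in LHS](row_RRe M_diag_ge0).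
have [s sd] := exists_sorting_perm d.
have Ps := perm_mx_unitary s.
exists (col_perm s d), (perm_mx s *m Q); split.
- by move=> i; rewrite !mxE; apply: Re_ge0.
- exact: sd.
- exact: mul_unitarymx.
- rewrite -absmx_sqr -/M {1 2}ME (unitary_conj_mul _ _ Qu) real_diagM.
  have -> : \row_i (col_perm s d) 0 i ^+ 2 = col_perm s (\row_i (d 0 i * d 0 i)).
    by apply/rowP => i; rewrite !mxE expr2.
  rewrite real_diag_perm adjmxM !mulmxA.
  rewrite -[_ *m _ *m perm_mx s]mulmxA (adj_unitaryK Ps) mulmx1.
  by rewrite -[_ *m _ *m perm_mx s]mulmxA (adj_unitaryK Ps) mulmx1.
- move=> r; rewrite /mxpow mxcalcE -/Q (norm_unitary_conj _ Qu).
  have -> : \row_i powR ((col_perm s d) 0 i) r = col_perm s (\row_i powR (d 0 i) r).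
    by apply/rowP => i; rewrite !mxE.
  rewrite (gauge_perm symmetric_gauge_norm).
  by set x := \row_i _; set y := \row_i _; suff -> : x = y by []; apply/rowP => i; rewrite !mxE.
Qed.

(** * The norm of a power of the modulus *)

Variable r : R.
Hypothesis r_ge0 : 0 <= r.

Let normpow T := N (mxpow (absmx T) r).

Lemma prod_powR (I : finType) (P : pred I) (x : I -> R) :
  (forall i, 0 <= x i) ->
  \prod_(i | P i) powR (x i) r = powR (\prod_(i | P i) x i) r.
Proof.
move=> x0.
suff [] : 0 <= \prod_(i | P i) x i /\
    \prod_(i | P i) powR (x i) r = powR (\prod_(i | P i) x i) r by [].
apply: (big_ind2 (fun y z => 0 <= y /\ z = powR y r)) => //.
- by rewrite powR1.
- by move=> y1 z1 y2 z2 [y10 ->] [y20 ->]; rewrite mulr_ge0 // powRM.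
Qed.

(** The product inequality for squared singular values is reduced to one for
    their r-th powers, which is the hypothesis of [gauge_log_majorization]. *)
Lemma norm_sandwich A B X : A^t* = A -> B^t* = B ->
  normpow (A *m X *m B) ^+ 2
  <= normpow (A *m A *m X) * normpow (X *m (B *m B)).
Proof.
move=> hA hB.
have [a [P [a0 ad Pu Pa Na]]] := singular_values (A *m X *m B).
have [b [Q [b0 bd Qu Qb Nb]]] := singular_values (A *m A *m X).
have [c [S [c0 cd Su Sc Nc]]] := singular_values (X *m (B *m B)).
(* Replace the norms by the gauge at powers of singular values. *)
have transport (x y z x' y' z' : R) : x = x' -> y = y' -> z = z' ->
    x' ^+ 2 <= y' * z' -> x ^+ 2 <= y * z by move=> -> -> ->.
apply: (transport _ _ _ _ _ _ (Na r) (Nb r) (Nc r)) => {transport}.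
have pow_ge0 (x : 'rV[R]_n) : nonneg_row (\row_i powR (x 0 i) r).
  by move=> i; rewrite mxE powR_ge0.
apply: (gauge_log_majorization symmetric_gauge_norm) => //.
  by move=> i j ij; rewrite !mxE ge0_ler_powR ?nnegrE // ad.
move=> k kn {Na Nb Nc}.
have powE (x : 'rV[R]_n) : nonneg_row x ->
    \prod_(i < n | (i < k)%N) (\row_i powR (x 0 i) r) 0 i
    = powR (\prod_(i < n | (i < k)%N) x 0 i) r.
  by move=> x0; rewrite -prod_powR //; apply: eq_bigr => i _; rewrite mxE.
rewrite !powE //.
have prod0 (x : 'rV[R]_n) : nonneg_row x -> 0 <= \prod_(i < n | (i < k)%N) x 0 i.
  by move=> x0; apply: prodr_ge0.
rewrite expr2 -!powRM ?prod0 //.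
apply: ge0_ler_powR; rewrite ?nnegrE ?mulr_ge0 ?prod0 //.
rewrite -expr2 -(@ler_pXn2r _ 2) ?nnegrE ?exprn_ge0 ?mulr_ge0 ?prod0 //.
pose sq (x : 'rV[R]_n) := map_mx (real_complex R) (\row_i x 0 i ^+ 2).
have sqE (x : 'rV[R]_n) i : sq x 0 i = (x 0 i ^+ 2)%:C by rewrite !mxE.
have sq0 (x : 'rV[R]_n) i : 0 <= sq x 0 i by rewrite sqE ler0c sqr_ge0.
have sqd (x : 'rV[R]_n) : nonneg_row x -> decreasing_row x ->
    forall i j : 'I_n, (i <= j)%N -> sq x 0 j <= sq x 0 i.
  move=> x0 xd i j ij; rewrite !sqE lecR.
  by rewrite ler_pXn2r ?nnegrE // xd.
have H : (\prod_(i < n | (i < k)%N) sq a 0 i) ^+ 2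
    <= (\prod_(i < n | (i < k)%N) sq b 0 i) * \prod_(i < n | (i < k)%N) sq c 0 i.
  exact: prod_spectral_sandwich kn hA hB Pu Qu Su Pa Qb Sc (sq0 a) (sq0 b)
    (sqd _ b0 bd) (sq0 c) (sqd _ c0 cd).
have prodE (x : 'rV[R]_n) : \prod_(i < n | (i < k)%N) sq x 0 i
    = ((\prod_(i < n | (i < k)%N) x 0 i) ^+ 2)%:C.
  by rewrite -prodrXl rmorph_prod; apply: eq_bigr => i _; rewrite sqE.
by move: H; rewrite !prodE -rmorphXn -rmorphM lecR [X in _ -> _ <= X]exprMn.
Qed.

(** Absorbs the outer factors of [norm_sandwich] into the neighbours of [X], which
    is the form in which powers of two fixed matrices can be substituted. *)
Lemma norm_sandwich_shift A B X (A0 A1 A2 B0 B1 B2 : 'M[C]_n) :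
    A^t* = A -> B^t* = B ->
    A *m A0 = A1 -> A *m A1 = A2 -> B0 *m B = B1 -> B1 *m B = B2 ->
  normpow (A1 *m X *m B1) ^+ 2 <= normpow (A2 *m X *m B0) * normpow (A0 *m X *m B2).
Proof.
move=> hA hB <- <- <- <-.
by have := norm_sandwich (A0 *m X *m B0) hA hB; rewrite !mulmxA.
Qed.

(** [norm_sandwich] for A^s, A^(t-s) X B^(1-t-s) and B^s. *)
Lemma norm_log_convex A B X (s t : R) : 0 <= s -> 0 <= t - s -> t + s <= 1 ->
  normpow (mxpow A t *m X *m mxpow B (1 - t)) ^+ 2
  <= normpow (mxpow A (t + s) *m X *m mxpow B (1 - (t + s)))
     * normpow (mxpow A (t - s) *m X *m mxpow B (1 - (t - s))).
Proof.
move=> s0 ts0 ts1.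
have powD (K : 'M[C]_n) (u v w : R) : 0 <= u -> 0 <= v -> u + v = w ->
    mxpow K u *m mxpow K v = mxpow K w.
  by move=> u0 v0 <-; apply: mxpowD.
apply: (norm_sandwich_shift X (mxpow_adj A s) (mxpow_adj B s)); apply: powD; lra.
Qed.

Definition bounded01 m p (F : R -> 'M[C]_(m, p)) :=
  exists c : R, forall t i j, 0 <= t <= 1 -> `|F t i j| <= c%:C.

Lemma bounded01_cst m p (K : 'M[C]_(m, p)) : bounded01 (fun=> K).
Proof.
exists (\sum_i \sum_j complex.Re `|K i j|) => t i j _.
have K_ge0 k l : 0 <= complex.Re `|K k l| by apply: Re_ge0.
rewrite -[`|K i j|]RRe_real ?normr_real // lecR (bigD1 i) //= (bigD1 j) //=.
rewrite -addrA lerDl; apply: addr_ge0; first by apply: sumr_ge0 => l _; apply: K_ge0.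
by apply: sumr_ge0 => k _; apply: sumr_ge0 => l _; apply: K_ge0.
Qed.

Lemma bounded01M m p q (F : R -> 'M[C]_(m, p)) (G : R -> 'M[C]_(p, q)) :
  bounded01 F -> bounded01 G -> bounded01 (fun t => F t *m G t).
Proof.
move=> [c Fc] [d Gd]; exists (\sum_(k < p) c * d) => t i j t01.
rewrite mxE rmorph_sum; apply: le_trans (ler_norm_sum _ _ _) _.
by apply: ler_sum => k _; rewrite normrM rmorphM ler_pM // ?Fc ?Gd.
Qed.

Lemma bounded01_adj m p (F : R -> 'M[C]_(m, p)) :
  bounded01 F -> bounded01 (fun t => (F t)^t*).
Proof. by move=> [c Fc]; exists c => t i j t01; rewrite !mxE norm_conjC Fc. Qed.

Lemma powR_le_1D (a t : R) : 0 <= t <= 1 -> powR a t <= 1 + powR a 1.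
Proof.
move=> /andP[t0 t1]; have p0 := powR_ge0 a 1.
have [a0|a0] := eqVneq a 0.
  have -> : powR a t = (t == 0)%:R by rewrite a0 /powR eqxx.
  by case: (t == 0); rewrite ?mulr0n ?mulr1n; lra.
suff [] : powR a t <= 1 \/ powR a t <= powR a 1 by lra.
rewrite /powR (negPf a0) mul1r expR_le1 ler_expR.
by have [l0|l0] := leP 0 (ln a); [right | left]; nra.
Qed.

(** In the fixed eigenbasis only the powers of the eigenvalues depend on [t]. *)
Lemma bounded01_mxpow A : bounded01 (mxpow A).
Proof.
pose a i := complex.Re (spectral_diag A 0 i).
have [c] : bounded01 (fun t => (spectralmx A)^t* *m real_diag (\row_i powR (a i) t)
    *m spectralmx A); last first.
  by move=> Ac; exists c => t i j /Ac; rewrite /mxpow mxcalcE.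
apply: bounded01M (bounded01_cst _).
apply: bounded01M (bounded01_cst _) _.
exists (\sum_i (1 + powR (a i) 1)) => t i j t01.
have term_ge0 k : 0 <= 1 + powR (a k) 1 by rewrite addr_ge0 // powR_ge0.
rewrite !mxE; case: eqP => _; last by rewrite mulr0n normr0 ler0c sumr_ge0.
rewrite mulr1n ger0_norm ?ler0c ?powR_ge0 // lecR (bigD1 i) //=.
apply: le_trans (powR_le_1D _ t01) _.
by rewrite lerDl sumr_ge0.
Qed.

(** Each squared singular value is at most the trace of the Gram matrix, which
    is bounded; dominance by a constant vector bounds the norm. *)
Lemma norm_bounded01 (F : R -> 'M[C]_n) : bounded01 F ->
  exists c, forall t, 0 <= t <= 1 -> normpow (F t) <= c.
Proof.
move=> Fb; have [c Hc] := bounded01M (bounded01_adj Fb) Fb.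
exists (N (real_diag (const_mx (powR (1 + `|\sum_(i < n) c|) r)))) => t t01.
rewrite /normpow; have [s [P [s0 sd Pu Ps ->]]] := singular_values (F t).
apply: (gauge_dominance symmetric_gauge_norm).
- by move=> i j ij; rewrite !mxE ge0_ler_powR ?nnegrE // sd.
- by move=> i; rewrite mxE powR_ge0.
move=> k kn; apply: ler_sum => i _; rewrite !mxE.
apply: ge0_ler_powR; rewrite ?nnegrE ?addr_ge0 //.
have tr_s : \sum_i s 0 i ^+ 2 <= \sum_(i < n) c.
  rewrite -lecR.
  have -> : (\sum_i s 0 i ^+ 2)%:C = \tr ((F t)^t* *m F t).
    rewrite Ps mxtrace_mulC mulmxA (unitarymxP Pu) mul1mx mxtrace_diag rmorph_sum.
    by apply: eq_bigr => j _; rewrite !mxE.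
  rewrite rmorph_sum /mxtrace; apply: ler_sum => j _.
  apply: le_trans (Hc t j j t01).
  by rewrite ger0_norm // gram_diag_ge0.
have si : s 0 i ^+ 2 <= `|\sum_(i < n) c|.
  apply: le_trans (ler_norm _); apply: le_trans tr_s.
  by rewrite (bigD1 i) //= lerDl sumr_ge0 // => j _; rewrite sqr_ge0.
by have := s0 i; nra.
Qed.
End MatrixPowers.

(** * Convexity from midpoint convexity *)

Section RealConvexity.
Variable R : realType.

(** Every point of [0, 1] is the midpoint of an endpoint and another point of
    [0, 1], so any upper bound of [h] can be halved, again and again. *)
Lemma midpoint_convex_le0 (h : R -> R) (c : R) :
    (forall x y, 0 <= x <= 1 -> 0 <= y <= 1 ->
       h ((x + y) / 2) <= (h x + h y) / 2) ->
    (forall x, 0 <= x <= 1 -> h x <= c) -> h 0 <= 0 -> h 1 <= 0 ->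
  forall x, 0 <= x <= 1 -> h x <= 0.
Proof.
move=> hmid hc h0 h1.
have halving k x : 0 <= x <= 1 -> h x <= `|c| / 2 ^+ k.
  elim: k x => [|k IH] x x01.
    by rewrite expr0 divr1; apply: le_trans (hc x x01) (ler_norm c).
  rewrite exprS invfM mulrCA.
  have [xle|xgt] := leP x (1 / 2).
    have x2 : 0 <= 2 * x <= 1 by lra.
    have := hmid 0 (2 * x) _ x2; have -> : (0 + 2 * x) / 2 = x by field.
    by move=> /(_ ltac:(lra)); have := IH _ x2; lra.
  have x2 : 0 <= 2 * x - 1 <= 1 by lra.
  have := hmid 1 (2 * x - 1) _ x2; have -> : (1 + (2 * x - 1)) / 2 = x by field.
  by move=> /(_ ltac:(lra)); have := IH _ x2; lra.
move=> x x01; rewrite leNgt; apply/negP => hx.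
have c_hx : 0 <= `|c| / h x by rewrite divr_ge0 // ltW.
have := halving (Num.bound (`|c| / h x)) x x01.
rewrite leNgt => /negP; apply.
rewrite ltr_pdivrMr ?exprn_gt0 // mulrC -ltr_pdivrMr //.
apply: lt_trans (archi_boundP c_hx) _.
by rewrite -natrX ltr_nat ltn_expl.
Qed.

(** Subtract the chord and apply [midpoint_convex_le0]. *)
Lemma midpoint_convex_segment (f : R -> R) (c : R) :
    (forall x y, 0 <= x <= 1 -> 0 <= y <= 1 ->
       f ((x + y) / 2) <= (f x + f y) / 2) ->
    (forall x, 0 <= x <= 1 -> `|f x| <= c) ->
  forall a b q, 0 <= a <= 1 -> 0 <= b <= 1 -> 0 <= q <= 1 ->
    f ((1 - q) * a + q * b) <= (1 - q) * f a + q * f b.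
Proof.
move=> fmid fc a b q a01 b01 q01; rewrite -subr_le0.
pose l x := (1 - x) * a + x * b.
have l01 x : 0 <= x <= 1 -> 0 <= l x <= 1 by rewrite /l => ?; apply/andP; split; nra.
pose h x := f (l x) - ((1 - x) * f a + x * f b).
(* On [0, 1] the chord contributes at most [2 c] in absolute value. *)
apply: (@midpoint_convex_le0 h (c + c + c)) => //.
- move=> x y x01 y01; rewrite /h.
  have -> : l ((x + y) / 2) = (l x + l y) / 2 by rewrite /l; field.
  by have := fmid _ _ (l01 x x01) (l01 y y01); lra.
- move=> x x01; have /ler_normlP[_ fl] := fc _ (l01 x x01).
  have /ler_normlP[fa _] := fc _ a01; have /ler_normlP[fb _] := fc _ b01.
  have c0 : 0 <= c by apply: le_trans (fc _ a01); apply: normr_ge0.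
  by rewrite /h; nra.
- by rewrite /h /l subr0 !mul1r !mul0r !addr0 subrr.
- by rewrite /h /l subrr !mul1r !mul0r !add0r subrr.
Qed.
End RealConvexity.

(** The passage from midpoint log-convexity to the two inequalities, for any
    bounded [g] in place of the norm of |A^t X B^(1-t)|^r.  The product of [g] with
    its mirror image [g'] inherits midpoint log-convexity and is symmetric about
    1/2. *)
Lemma log_convex_product_refinement (R : realType) (g g' : R -> R) (m mu p c : R) :
    (forall t, g' t = g (1 - t)) -> m = g (1 / 2) -> (forall t, 0 <= g t) ->
    (forall s t, 0 <= s -> 0 <= t - s -> t + s <= 1 ->
       g t ^+ 2 <= g (t + s) * g (t - s)) ->
    (forall t, 0 <= t <= 1 -> g t <= c) ->
    0 <= mu <= 1 -> 0 < p < 1 ->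
  let f := fun t => g t * g' t in
  g mu * g' mu - m ^+ 2 >= 1 / p * (f ((1 - p) / 2 + p * mu) - m ^+ 2)
  /\ 1 / p * (f ((1 - p) / 2 + p * mu) - m ^+ 2) >= 0.
Proof.
move=> g'E mE g_ge0 g_mid gc hmu hp f.
have fE t : f t = g t * g (1 - t) by rewrite /f g'E.
have fC t : f (1 - t) = f t by rewrite !fE subKr mulrC.
have half : 1 - 1 / 2 = 1 / 2 :> R by field.
have f_mid x y : 0 <= x <= 1 -> 0 <= y <= 1 ->
    f ((x + y) / 2) <= (f x + f y) / 2.
  wlog xy : x y / x <= y => [H x01 y01|x01 y01].
    have [xy|/ltW yx] := leP x y; first exact: H.
    by rewrite addrC [f x + _]addrC; apply: H.
  pose t := (x + y) / 2; pose s := (y - x) / 2.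
  have H1 : g t ^+ 2 <= g y * g x.
    have -> : y = t + s by rewrite /t /s; field.
    have -> : x = t - s by rewrite /t /s; field.
    by apply: g_mid; rewrite /t /s; lra.
  have H2 : g (1 - t) ^+ 2 <= g (1 - x) * g (1 - y).
    have -> : 1 - x = (1 - t) + s by rewrite /t /s; field.
    have -> : 1 - y = (1 - t) - s by rewrite /t /s; field.
    by apply: g_mid; rewrite /t /s; lra.
  have f_ge0 u : 0 <= f u by rewrite fE mulr_ge0.
  rewrite -/t -(@ler_pXn2r _ 2) ?nnegrE ?divr_ge0 ?addr_ge0 //.
  apply: le_trans (leif_AGM2 (f x) (f y)).1.
  rewrite !fE exprMn; apply: le_trans (ler_pM _ _ H1 H2) _; rewrite ?exprn_ge0 //.
  rewrite le_eqVlt; apply/orP; left; apply/eqP; ring.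
have f_half : f (1 / 2) = m ^+ 2 by rewrite fE half mE expr2.
have [p0 p1] : 0 < p /\ p < 1 by case/andP: hp.
have half_le t : 0 <= t <= 1 -> m ^+ 2 <= f t.
  move=> t01; rewrite -f_half; have := f_mid t (1 - t) t01.
  have -> : (t + (1 - t)) / 2 = 1 / 2 by field.
  by rewrite fC => /(_ ltac:(lra)); lra.
have f_seg : f ((1 - p) / 2 + p * mu) <= (1 - p) * m ^+ 2 + p * f mu.
  have -> : (1 - p) / 2 = (1 - p) * (1 / 2) by field.
  rewrite -f_half; apply: (@midpoint_convex_segment R f (c * c)) => //; try lra.
  move=> x x01; rewrite fE ger0_norm ?mulr_ge0 //.
  by apply: ler_pM => //; apply: gc; lra.
have seg01 : 0 <= (1 - p) / 2 + p * mu <= 1 by apply/andP; split; nra.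
split; last first.
  apply: mulr_ge0; first by rewrite divr_ge0 // ltW.
  by rewrite subr_ge0 half_le.
rewrite -/(f mu) mulrC mulrA mulr1 ler_pdivrMr //.
lra.
Qed.

Local Open Scope complex_scope.

Theorem theorem3p3 (R : realType) (n : nat) (A B X : 'M[R[i]]_n)
    (r mu p : R) (N : 'M[R[i]]_n -> R)
    (hA : psdmx A) (hB : psdmx B) (hr : 0 <= r)
    (hmu : 0 <= mu <= 1) (hp : 0 < p < 1)
    (hN : unitarily_invariant_norm N) :
  let f := fun t : R =>
    N (mxpow (absmx (mxpow A t *m X *m mxpow B (1 - t))) r)
      * N (mxpow (absmx (mxpow A (1 - t) *m X *m mxpow B t)) r) in
  let m := N (mxpow (absmx (mxpow A (1 / 2) *m X *m mxpow B (1 / 2))) r) in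
  N (mxpow (absmx (mxpow A mu *m X *m mxpow B (1 - mu))) r)
      * N (mxpow (absmx (mxpow A (1 - mu) *m X *m mxpow B mu)) r) - m ^+ 2
    >= 1 / p * (f ((1 - p) / 2 + p * mu) - m ^+ 2)
  /\ 1 / p * (f ((1 - p) / 2 + p * mu) - m ^+ 2) >= 0.
Proof.
have bnd : exists c, forall t, 0 <= t <= 1 ->
    N (mxpow (absmx (mxpow A t *m X *m mxpow B (1 - t))) r) <= c.
  have [d Hd] := bounded01_mxpow B.
  apply: (norm_bounded01 hN hr (F := fun t => mxpow A t *m X *m mxpow B (1 - t))).
  apply: bounded01M; first exact: bounded01M (bounded01_mxpow A) (bounded01_cst X).
  by exists d => t i j t01; apply: Hd; lra.
have [c gc] := bnd.
apply: (log_convex_product_refinement _ _ _ (norm_log_convex hN hr A B X) gc hmu hp).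
- by move=> t; rewrite (subKr 1 t).
- by have -> : 1 - 1 / 2 = 1 / 2 :> R by field.
- by move=> t; apply: matrix_norm_ge0 hN.1 _.
Qed.
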